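(* Let $G$ be a graph without isolated vertices and let $H$ be a nontrivial graph with root $v\in V(H)$. Then $$\gamma_R(G\circ_v H)\in\{n(G)\gamma_R(H),\ \gamma_R(G)+n(G)(\gamma_R(H)-1),\ \gamma(G)+n(G)(\gamma_R(H)-1)\}.$$
   Context: All graphs are finite and simple; a graph is nontrivial if it has at least two vertices; $n(G)=|V(G)|$. For a graph $G$ and a nontrivial graph $H$ with a root $v\in V(H)$, the rooted product graph $G\circ_v H$ is obtained by taking one copy of $G$ and $n(G)$ copies of $H$, and identifying the $i$-th vertex of $G$ with the vertex $v$ in the $i$-th copy of $H$, for each $i$. $\gamma(G)$ is the domination number (minimum size of a set $S$ such that every vertex is in $S$ or adjacent to a vertex of $S$). A Roman dominating function on a graph $X$ is $f:V(X)\to\{0,1,2\}$ such that every vertex with value $0$ has a neighbor with value $2$; $\gamma_R(X)$ is the minimum of $\sum_u f(u)$ over such $f$. *)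

(* Defs.v *)
From mathcomp Require Import all_boot.

Set Implicit Arguments.
Unset Strict Implicit.
Unset Printing Implicit Defensive.

Record sgraph := SGraph {
  vertex :> finType;
  adj : rel vertex;
  adj_sym : symmetric adj;
  adj_irr : irreflexive adj }.

Definition no_isolated (G : sgraph) : Prop := forall u : G, exists w : G, adj u w.

Definition dominating (G : sgraph) (S : {set G}) : bool :=
  [forall u, (u \in S) || [exists w in S, adj u w]].

Definition domination_number (G : sgraph) : nat :=
  #|[arg min_(S < [set: G] | dominating S) #|S| ]|.

Definition roman_dominating (G : sgraph) (f : {ffun G -> 'I_3}) : bool :=
  [forall u, (f u == 0 :> nat) ==> [exists w, adj u w && (f w == 2 :> nat)]].

Definition weight (G : sgraph) (f : {ffun G -> 'I_3}) : nat := \sum_u f u.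

Definition roman_domination_number (G : sgraph) : nat :=
  @weight G [arg min_(f < [ffun=> ord_max] | @roman_dominating G f) @weight G f].

(* The pair (x, a) is the vertex a of the x-th copy of H; the vertex x of G is
   identified with (x, v), the root of that copy. *)
Section RootedProduct.
Variables (G H : sgraph) (v : H).

Definition rooted_adj (p q : G * H) : bool :=
  ((p.1 == q.1) && adj p.2 q.2) || [&& p.2 == v, q.2 == v & adj p.1 q.1].

Lemma rooted_adj_sym : symmetric rooted_adj.
Proof.
move=> p q; rewrite /rooted_adj eq_sym (adj_sym p.2) (adj_sym p.1).
by congr (_ || _); rewrite andbCA.
Qed.

Lemma rooted_adj_irr : irreflexive rooted_adj.
Proof. by move=> p; rewrite /rooted_adj !adj_irr !andbF. Qed.

Definition rooted_product : sgraph :=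
  @SGraph (G * H)%type rooted_adj rooted_adj_sym rooted_adj_irr.

End RootedProduct.

(* The default arguments of the two arg min above are admissible, so both
   parameters are genuine minima. *)
Lemma dominating_setT (G : sgraph) : dominating [set: G].
Proof. by apply/forallP => u; rewrite inE. Qed.

Lemma roman_dominating_cst2 (G : sgraph) :
  @roman_dominating G [ffun=> ord_max].
Proof. by apply/forallP => u; rewrite ffunE. Qed.

Lemma domination_numberP (G : sgraph) :
  (exists2 S : {set G}, dominating S & #|S| = domination_number G) /\
  (forall S : {set G}, dominating S -> domination_number G <= #|S|).
Proof.
rewrite /domination_number; case: arg_minnP => [|S dS minS].
  exact: dominating_setT.
by split; [exists S | exact: minS].
Qed.

Lemma roman_domination_numberP (G : sgraph) :
  (exists2 f : {ffun G -> 'I_3},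
     roman_dominating f & weight f = roman_domination_number G) /\
  (forall f : {ffun G -> 'I_3},
     roman_dominating f -> roman_domination_number G <= weight f).
Proof.
rewrite /roman_domination_number; case: arg_minnP => [|f df minf].
  exact: roman_dominating_cst2.
by split; [exists f | exact: minf].
Qed.

(* Hence the truncated subtraction of 1 from this number is the true one
   whenever the graph has a vertex. *)
Lemma roman_domination_number_gt0 (G : sgraph) :
  0 < #|G| -> 0 < roman_domination_number G.
Proof.
have [[f /forallP df <-] _] := roman_domination_numberP G.
case/card_gt0P => u _; rewrite lt0n sum_nat_eq0; apply/negP => /forallP f0.
have {}f0 w : f w == 0 :> nat by have := f0 w.
have := df u; rewrite f0 => /existsP[w /andP[_ /eqP fw]].
by have := f0 w; rewrite fw.
Qed.

(* Main.v *)
Require Import Defs.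
From mathcomp Require Import all_boot zify.

(** Let r be the Roman domination number of H. The restriction of a Roman
    dominating function of the product to a copy of H satisfies the Roman
    condition except possibly at the root; if it fails there, raising the root
    from 0 to 1 repairs it, so each copy has weight at least r - 1. If no
    function that is Roman off the root has weight r - 1, the first value
    occurs. Otherwise a copy of weight r - 1 needs a neighbouring copy whose
    root has value 2, and the last two values occur according to whether the
    least weight of a Roman dominating function of H with value 2 at the root
    is r + 1 or r: the copies of weight at least r then encode a Roman
    dominating function, respectively a dominating set, of G. *)

Set Implicit Arguments.
Unset Strict Implicit.
Unset Printing Implicit Defensive.

Lemma roman_domination_number_eq (G : sgraph) (k : nat) :
    (exists2 f : {ffun G -> 'I_3}, roman_dominating f & weight f <= k) ->
    (forall f : {ffun G -> 'I_3}, roman_dominating f -> k <= weight f) ->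
  roman_domination_number G = k.
Proof.
have [[f0 rf0 <-] minf0] := roman_domination_numberP G.
case=> f rf lefk lek; apply/eqP; rewrite eqn_leq lek // andbT.
exact: leq_trans (minf0 _ rf) lefk.
Qed.

Lemma card_sum_mem (T : finType) (S : {set T}) : #|S| = \sum_x (x \in S).
Proof.
by rewrite -sum1_card big_mkcond; apply: eq_bigr => x _; case: (x \in S).
Qed.

(** * Functions on one copy that may violate the Roman condition at the root *)

Section RomanOff.
Variables (H : sgraph) (v : H).
Implicit Type h : {ffun H -> 'I_3}.

Definition roman_at h (u : H) : bool :=
  (h u == 0 :> nat) ==> [exists w, adj u w && (h w == 2 :> nat)].

Definition roman_off h : bool := [forall u, (u != v) ==> roman_at h u].

Lemma roman_dominating_off h :
  roman_dominating h = roman_off h && roman_at h v.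
Proof.
apply/forallP/andP => [rh | [/forallP offh ath] u].
  by split; [apply/forallP => u; apply/implyP => _; apply: rh | apply: rh].
by have [-> // | uv] := eqVneq u v; have := offh u; rewrite uv.
Qed.

Definition set_root h (i : 'I_3) : {ffun H -> 'I_3} :=
  [ffun u => if u == v then i else h u].

Lemma set_root_root h i : set_root h i v = i.
Proof. by rewrite ffunE eqxx. Qed.

Lemma weight_set_root h (i : 'I_3) :
  h v = 0 :> nat -> weight (set_root h i) = weight h + i.
Proof.
move=> hv0; rewrite /weight (bigD1 v) //= [in RHS](bigD1 v) //= hv0 add0n.
rewrite set_root_root addnC; congr (_ + _).
by apply: eq_bigr => u /negPf uv; rewrite ffunE uv.
Qed.

(** A root of value 0 protects none of its neighbours, so changing its value cannot break the
    condition elsewhere. *)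
Lemma roman_off_set_root h i :
  h v = 0 :> nat -> roman_off h -> roman_off (set_root h i).
Proof.
move=> hv0 /forallP offh; apply/forallP => u; apply/implyP => uv.
have := offh u; rewrite uv /roman_at ffunE (negPf uv) /=.
case: eqP => //= _ /existsP[w /andP[uw hw]]; apply/existsP; exists w.
by rewrite uw ffunE; have [wv | //] := eqVneq w v; rewrite wv hv0 in hw.
Qed.

Lemma roman_set_root h (i : 'I_3) :
    h v = 0 :> nat -> roman_off h -> 0 < i ->
  roman_dominating (set_root h i).
Proof.
move=> hv0 offh i_gt0; rewrite roman_dominating_off roman_off_set_root //=.
by rewrite /roman_at set_root_root eqn0Ngt i_gt0.
Qed.

Lemma roman_off_root0 h :
  roman_off h -> ~~ roman_dominating h -> h v = 0 :> nat.
Proof.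
by move=> offh; rewrite roman_dominating_off offh negb_imply => /andP[/eqP].
Qed.

Lemma roman_off_weight h :
  roman_off h -> roman_domination_number H <= (weight h).+1.
Proof.
move=> offh; have [_ minH] := roman_domination_numberP H.
have [rh | nrh] := boolP (roman_dominating h).
  exact: leqW (minH _ rh).
have hv0 := roman_off_root0 offh nrh.
pose one := Ordinal (isT : 1 < 3).
have /minH := @roman_set_root h one hv0 offh isT.
by rewrite weight_set_root // addn1.
Qed.

End RomanOff.

(** * Roman domination of the product, copy by copy *)

Section RootedRoman.
Variables (G H : sgraph) (v : H).
Let GH := rooted_product G v.

Definition copy (F : {ffun GH -> 'I_3}) (x : G) : {ffun H -> 'I_3} :=
  [ffun a => F (x, a)].

Definition glue (h : G -> {ffun H -> 'I_3}) : {ffun GH -> 'I_3} :=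
  [ffun p => h p.1 p.2].

Lemma copy_glue h x : copy (glue h) x = h x.
Proof. by apply/ffunP => a; rewrite !ffunE. Qed.

Lemma weight_copy F : weight F = \sum_x weight (copy F x).
Proof.
rewrite /weight pair_big; apply: eq_bigr => -[x a] _.
by rewrite ffunE.
Qed.

(** A non-root vertex has all its neighbours in its own copy; a root also sees other roots, and only
    those. Help from outside thus reaches a copy only at its root. *)
Lemma roman_dominating_copy F :
  roman_dominating F <->
  forall x, roman_off v (copy F x) /\
    (roman_dominating (copy F x) \/
     exists2 y, adj x y & copy F y v = 2 :> nat).
Proof.
split=> [/forallP rF x | rF].
  have offx : roman_off v (copy F x).
    apply/forallP => u; apply/implyP => uv; rewrite /roman_at ffunE.
    apply/implyP => /(implyP (rF (x, u))) /existsP[[y w] /andP[]].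
    rewrite /= /rooted_adj /= (negPf uv) orbF => /andP[/eqP <- uw] Fw.
    by apply/existsP; exists w; rewrite uw ffunE.
  split=> //; rewrite (roman_dominating_off v) offx /= /roman_at ffunE.
  have := rF (x, v); case: eqP => //= _; last by left.
  case/existsP=> -[y w] /andP[/= /orP[/andP[/= /eqP <- vw] | /and3P[_ /= /eqP wv xy]] Fw].
    by left; apply/existsP; exists w; rewrite vw ffunE.
  by right; exists y; rewrite // ffunE -wv (eqP Fw).
apply/forallP => -[x u]; apply/implyP => Fu.
have [/forallP offx rx] := rF x.
have inner : roman_at (copy F x) u ->
    [exists w : GH, adj ((x, u) : GH) w && (F w == 2 :> nat)].
  rewrite /roman_at ffunE Fu => /existsP[w /andP[uw]]; rewrite ffunE => Fw.
  by apply/existsP; exists (x, w); rewrite /= /rooted_adj /= eqxx uw Fw.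
have [uv | uv] := eqVneq u v; last first.
  by apply: inner; have := offx u; rewrite uv.
case: rx => [/forallP /(_ u) /inner // | [y xy]]; rewrite ffunE => Fy.
by apply/existsP; exists (y, v); rewrite /= /rooted_adj /= uv eqxx xy orbT Fy.
Qed.

Lemma roman_dominating_glue h :
    (forall x, roman_off v (h x) /\
      (roman_dominating (h x) \/ exists2 y, adj x y & h y v = 2 :> nat)) ->
  roman_dominating (glue h).
Proof.
move=> hP; apply/roman_dominating_copy => x; rewrite copy_glue.
have [offx rx] := hP x; split=> //; case: rx => [|[y xy hy]]; first by left.
by right; exists y; rewrite ?copy_glue.
Qed.

Lemma weight_glue h : weight (glue h) = \sum_x weight (h x).
Proof. by rewrite weight_copy; apply: eq_bigr => x _; rewrite copy_glue. Qed.

Let r := roman_domination_number H.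

Lemma rooted_roman_le F x :
  roman_dominating (copy F x) -> r <= weight (copy F x).
Proof. by have [_] := roman_domination_numberP H; apply. Qed.

Lemma rooted_product_roman_no_defect :
    (forall h, roman_off v h -> r <= weight h) ->
  roman_domination_number GH = #|G| * r.
Proof.
move=> rmin; apply: roman_domination_number_eq => [|F].
  have [[h rh wh] _] := roman_domination_numberP H.
  exists (glue (fun=> h)).
    apply: roman_dominating_glue => x; split; last by left.
    by move: rh; rewrite (roman_dominating_off v) => /andP[].
  by rewrite weight_glue sum_nat_const wh.
move=> /roman_dominating_copy rF; rewrite weight_copy -sum_nat_const.
by apply: leq_sum => x _; apply: rmin; have [] := rF x.
Qed.

(** * Copies that can save one unit of weight *)

Section Defect.
Variable h0 : {ffun H -> 'I_3}.
Hypotheses (offh0 : roman_off v h0) (h0_lt : weight h0 < r).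

Lemma defect_root0 : h0 v = 0 :> nat.
Proof.
apply: (roman_off_root0 offh0); apply: contraTN h0_lt => rh0.
by rewrite -leqNgt; have [_] := roman_domination_numberP H; apply.
Qed.

Lemma defect_weight : weight h0 = r - 1.
Proof. by have := roman_off_weight offh0; move: h0_lt; rewrite -/r; lia. Qed.

(** Placing [h2] over a minimum dominating set and [h0] elsewhere costs [r - 1] per copy plus one
    unit per chosen vertex. *)
Lemma rooted_product_roman_light (h2 : {ffun H -> 'I_3}) :
    roman_dominating h2 -> h2 v = 2 :> nat -> weight h2 = r ->
  roman_domination_number GH = domination_number G + #|G| * (r - 1).
Proof.
move=> rh2 h2v wh2; have [[S domS cardS] minS] := domination_numberP G.
apply: roman_domination_number_eq => [|F /roman_dominating_copy rF].
  pose h x := if x \in S then h2 else h0.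
  exists (glue h).
    apply: roman_dominating_glue => x; rewrite /h.
    have [xS | xS] := boolP (x \in S).
      split; last by left.
      by move: rh2; rewrite (roman_dominating_off v) => /andP[].
    split=> //; right; have /forallP/(_ x) := domS.
    rewrite (negPf xS) /= => /existsP[y /andP[yS xy]].
    by exists y; rewrite ?yS.
  rewrite weight_glue -cardS card_sum_mem -sum_nat_const -big_split /=.
  apply: leq_sum => x _; rewrite /h; case: ifP => _; rewrite ?defect_weight ?wh2; lia.
(* A copy outside [T] is too light to be Roman dominating, so a neighbouring root has value 2. That
   value settles the condition at the neighbour's root, so the neighbour's copy is Roman dominating
   and lies in [T]. *)
pose T := [set x | r <= weight (copy F x)].
have domT : dominating T.
  apply/forallP => x; rewrite inE; have [_ [|[y xy Fy]]] := rF x.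
    by move/rooted_roman_le->.
  apply/orP; right; apply/existsP; exists y; rewrite xy andbT inE.
  have [offy _] := rF y; apply: rooted_roman_le.
  by rewrite (roman_dominating_off v) offy /roman_at Fy.
apply: leq_trans (leq_add (minS _ domT) (leqnn _)) _.
rewrite weight_copy card_sum_mem -sum_nat_const -big_split /=.
apply: leq_sum => x _; rewrite inE; have [offx _] := rF x.
(* [h0_lt] forces [r] to be positive, so the truncated [r - 1] is exact. *)
have := roman_off_weight offx; have := h0_lt; rewrite -/r.
case: (leqP r) => _ /=; lia.
Qed.

(** For the upper bound, the values of an optimal [g] are planted on the roots of copies of [h0],
    whose root value is 0. *)
Lemma rooted_product_roman_heavy :
    (forall h, roman_dominating h -> h v = 2 :> nat -> r < weight h) ->
  roman_domination_number GH = roman_domination_number G + #|G| * (r - 1).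
Proof.
move=> heavy; have [[g rg wg] ming] := roman_domination_numberP G.
have h0v := defect_root0.
apply: roman_domination_number_eq => [|F /roman_dominating_copy rF].
  exists (glue (fun x => set_root v h0 (g x))).
    apply: roman_dominating_glue => x; split; first exact: roman_off_set_root.
    have [gx0 | gx0] := posnP (g x); last by left; apply: roman_set_root.
    have /forallP/(_ x) := rg; rewrite gx0 => /existsP[y /andP[xy /eqP gy]].
    by right; exists y; rewrite // set_root_root.
  rewrite weight_glue -wg -sum_nat_const -big_split /=.
  apply: leq_sum => x _; rewrite weight_set_root // defect_weight.
  by rewrite addnC.
pose one := Ordinal (isT : 1 < 3).
(* The root values of [F] can fail on [G] only at a root of value 0 protected inside its own copy.
   Such a copy weighs at least [r], and its spare unit pays for the value 1. *)
pose g' : {ffun G -> 'I_3} :=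
  [ffun x => if (copy F x v == 0 :> nat) && (r <= weight (copy F x)) then one
             else copy F x v].
have rg' : roman_dominating g'.
  apply/forallP => x; apply/implyP; rewrite [g' x]ffunE; have [_ rx] := rF x.
  case: ifP => // /negP nx Fx.
  case: rx => [/rooted_roman_le rx | [y xy Fy]]; first by case: nx; rewrite Fx.
  by apply/existsP; exists y; rewrite xy ffunE Fy /= Fy.
apply: leq_trans (leq_add (ming _ rg') (leqnn _)) _.
rewrite weight_copy -sum_nat_const -big_split /=.
apply: leq_sum => x _; rewrite ffunE; have [offx _] := rF x.
have := roman_off_weight offx; have := h0_lt; rewrite -/r => r_gt lex.
case: ifP => [/andP[_ rx] | _]; first by rewrite /=; lia.
have [-> | Fx0] := posnP (copy F x v); first by lia.
have rx : roman_dominating (copy F x).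
  by rewrite (roman_dominating_off v) offx /roman_at eqn0Ngt Fx0.
have := rooted_roman_le rx; have := heavy _ rx; have := ltn_ord (copy F x v).
(* Value 1 needs only weight [r]; value 2 needs the extra unit given by [heavy]. *)
by have [->|] := eqVneq (copy F x v : nat) 2; lia.
Qed.

End Defect.

End RootedRoman.

Theorem theorem3p5 (G H : sgraph) (v : H)
    (hG : no_isolated G) (hH : 1 < #|H|) :
  roman_domination_number (rooted_product G v) \in
    [:: #|G| * roman_domination_number H;
        roman_domination_number G + #|G| * (roman_domination_number H - 1);
        domination_number G + #|G| * (roman_domination_number H - 1)].
Proof.
set r := roman_domination_number H; rewrite !inE.
have [/existsP[h0 /andP[offh0 h0_lt]] | noh0] :=
    boolP [exists h : {ffun H -> 'I_3}, roman_off v h && (weight h < r)].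
  have [/existsP[h2 /and3P[rh2 /eqP h2v /eqP wh2]] | noh2] := boolP
      [exists h : {ffun H -> 'I_3},
        [&& roman_dominating h, h v == 2 :> nat & weight h == r]].
    by rewrite (rooted_product_roman_light _ offh0 h0_lt rh2 h2v wh2) eqxx !orbT.
  (* A Roman dominating function has weight at least [r], and [noh2] excludes equality when the root
     has value 2. *)
  rewrite (rooted_product_roman_heavy _ offh0 h0_lt) ?eqxx ?orbT // => h rh hv.
  have [_ /(_ h rh)] := roman_domination_numberP H.
  rewrite leq_eqVlt => /orP[/eqP rw | //].
  by case/existsP: noh2; exists h; rewrite rh hv -rw /=.
rewrite (@rooted_product_roman_no_defect _ _ v) ?eqxx // => h offh.
rewrite leqNgt; apply: contra noh0 => h_lt.
by apply/existsP; exists h; rewrite offh.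
Qed.
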